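(* Let $d, q \ge 2$ be fixed integers. Then \[ f_d(q,k) = (1+o_k(1))\, \frac{k}{e}\, q^{k^{d-1}/d}, \] where $f_d(q,k)$ is the minimum $n$ such that there exists a $k$-universal $d$-array of order $n$ over the $q$-symbol alphabet, and $o_k(1)$ denotes a quantity tending to $0$ as $k\to\infty$ with $d,q$ fixed.
   Context: Let $\Sigma = [q] = \{1,\dots,q\}$ be an alphabet with $q$ symbols. For positive integers $n_1,\dots,n_d$, a $d$-array of size $(n_1,\dots,n_d)$ over $\Sigma$ is a collection of symbols $a_{\mathbf{i}} \in \Sigma$ indexed by the vectors $\mathbf{i} \in [n_1]\times\dots\times[n_d]$, where $[m]=\{1,\dots,m\}$. A $d$-array of order $n$ is a $d$-array of size $(n,n,\dots,n)$. The coordinate restriction operation on a $d$-array $A=(a_{\mathbf{i}})$ of size $(n_1,\dots,n_d)$ is: choose some $j\in[d]$ and $\ell\in[n_j]$, and delete all the symbols whose $j$-th coordinate is $\ell$, to obtain a $d$-array of size $(n_1,\dots,n_{j-1},n_j-1,n_{j+1},\dots,n_d)$ (with the remaining $j$-th coordinates relabelled in order). A $d$-array $A$ contains a $d$-array $A'$ if $A'$ can be obtained from $A$ by iteratively applying coordinate restriction operations. A $d$-array over $\Sigma$ is $k$-universal if it contains every $d$-array over $\Sigma$ of size $(n_1,\dots,n_d)$ with $n_j \le k$ for all $j\in[d]$ (equivalently, every $d$-array over $\Sigma$ of order $k$). Here $e$ is the base of the natural logarithm. *)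

(* Defs.v *)
From HB Require Import structures.
From mathcomp Require Import all_boot all_order all_algebra.
From mathcomp Require Import all_classical all_reals all_analysis.
Set Implicit Arguments.
Unset Strict Implicit.
Unset Printing Implicit Defensive.
Import Order.TTheory GRing.Theory Num.Theory.
Import numFieldNormedType.Exports.

(* A d-array of size (n_1, ..., n_d) over a q-symbol alphabet. Symbols and
   coordinates are numbered from 0. Sizes with a zero component are not excluded
   by the type; [universal] only quantifies over positive sizes. *)
Definition darray (q d : nat) (n : 'I_d -> nat) : Type :=
  {ffun {dffun forall j : 'I_d, 'I_(n j)} -> 'I_q}.

Definition restrict_size (d : nat) (n : 'I_d -> nat) (j : 'I_d) : 'I_d -> nat :=
  fun i => if i == j then (n i).-1 else n i.

Lemma restrict_index_subproof (d : nat) (n : 'I_d -> nat) (j : 'I_d)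
    (l : 'I_(n j)) (i : 'I_d) (x : 'I_(restrict_size n j i)) :
  (if i == j then bump l x else x) < n i.
Proof.
case: x => x /=; rewrite /restrict_size; case: eqP => // _ ltx.
apply: leq_trans (_ : x.+2 <= _); first by rewrite /bump; case: (l <= x).
by case: (n i) ltx.
Qed.

(* [bump l] skips the deleted value l, so this is the position, before deleting
   the l-th slice in direction j, of the entry which has index v afterwards. *)
Definition restrict_index (d : nat) (n : 'I_d -> nat) (j : 'I_d) (l : 'I_(n j))
    (v : {dffun forall i : 'I_d, 'I_(restrict_size n j i)}) :
    {dffun forall i : 'I_d, 'I_(n i)} :=
  [ffun i : 'I_d => Ordinal (restrict_index_subproof l (v i))].

Definition restrict (q d : nat) (n : 'I_d -> nat) (A : darray q n)
    (j : 'I_d) (l : 'I_(n j)) : darray q (restrict_size n j) :=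
  [ffun v => A (restrict_index l v)].

Inductive contains (q d : nat) :
    forall n : 'I_d -> nat, darray q n ->
    forall m : 'I_d -> nat, darray q m -> Prop :=
| contains_refl (n : 'I_d -> nat) (A : darray q n) : contains A A
| contains_restrict (n m : 'I_d -> nat) (A : darray q n) (B : darray q m)
    (j : 'I_d) (l : 'I_(n j)) :
    contains (restrict A l) B -> contains A B.

Definition universal (q d k : nat) (n : 'I_d -> nat) (A : darray q n) : Prop :=
  forall (m : 'I_d -> nat) (B : darray q m),
    (forall j : 'I_d, 0 < m j <= k) -> contains A B.

Definition has_universal (d q k n : nat) : Prop :=
  exists A : darray q (fun _ : 'I_d => n), universal k A.

(* f_d(q, k), with value 0 should no such n exist. *)
Definition min_universal (d q k : nat) : nat :=
  xget 0 [set n | has_universal d q k n /\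
                  forall n', has_universal d q k n' -> n <= n']%classic.

(* Main.v *)
Require Import Defs.
From mathcomp Require Import all_boot all_order all_algebra.
From mathcomp Require Import all_classical all_reals all_analysis.
From mathcomp Require Import zify ring lra.
Set Implicit Arguments.
Unset Strict Implicit.
Import Order.TTheory GRing.Theory Num.Theory.
Import numFieldNormedType.Exports.

(** Write Q for q ^ (k ^ (d-1) / d), so that Q ^ (k d) = q ^ (k ^ d) is the
    number of arrays of order k.

    An array of order n has C(n,k) ^ d subarrays of order k, and a universal
    one shows all q ^ (k ^ d) arrays among them. Hence
    q ^ (k ^ d) <= C(n,k) ^ d <= (n ^ k / k!) ^ d, and k! >= (k/e) ^ k gives
    n >= (k/e) Q ([has_universal_bin], [side_ge]).

    Conversely, let n be least with C(n,k) ^ d >= M q ^ (k ^ d), where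
    M = 2 q k ^ d. By minimality and k! <= e k (k/e) ^ k, this n is at most
    (1 + o(1)) (k/e) Q, because (M (e k) ^ d) ^ (1/(k d)) tends to 1 ([side_le]). It
    remains to see that a uniformly random array A of order n is universal with
    positive probability. Fix B of order k. For a d-tuple I of k-subsets of the
    coordinates, let E_I be the event that A restricted to the box of I equals B;
    it has probability q ^ (- k ^ d), and the expected number of such events is
    at least M. The union bound over the q ^ (k ^ d) arrays B succeeds if no E_I
    occurs with probability at most exp(- M/2).

    Second moments do not give so small a probability, and the events E_I are not
    monotone, so that correlation inequalities of FKG type do not apply. An
    argument in the style of the local lemma takes their place. All
    events are cylinders, and an event is independent of any family of cylinders
    on cells outside its own box. If boxes meet rarely, dropping from a set of
    avoided events all those whose box meets a given box changes the probability
    of avoidance by a factor at most 2 ([avoid_remove_meeting]). Consequently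
    the events can be avoided one after another, each at the price of a factor
    1 - q ^ (- k ^ d) / 2 ([avoid_step], [card_avoid]), provided that, for each I,
    the sum of q ^ #|box I :&: box J| over the J <> I whose box meets that of I
    is at most q ^ (k ^ d) / 8.

    To check this condition, group the J by the sizes s_j of I_j :&: J_j
    ([overlap_sum_le]). There are at most (k+1) ^ d groups, and the group of s
    contributes at most the product of the C(k,s_j) C(n,k-s_j), times
    q ^ (prod s_j). The arithmetic-geometric inequality bounds prod s_j by the
    d-th power of the mean a of the s_j. For a <= k/2 this makes the gain
    n ^ (- s_j) beat q ^ (prod s_j); for a > k/2 one compares with the diagonal
    term s_j = k instead. In both cases a group contributes at most a polynomial
    in k times q ^ (k ^ d) / sqrt Q ([overlap_term_le]), and sqrt Q grows
    exponentially in k. *)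

(** * Containment and increasing embeddings *)

Definition emb (d : nat) (n m : 'I_d -> nat) (f : forall j, 'I_(m j) -> 'I_(n j))
    (v : {dffun forall j : 'I_d, 'I_(m j)}) : {dffun forall j : 'I_d, 'I_(n j)} :=
  [ffun j => f j (v j)].

Definition embeds (q d : nat) (n m : 'I_d -> nat) (A : darray q n) (B : darray q m) :=
  exists f : forall j, 'I_(m j) -> 'I_(n j),
    (forall j, {homo f j : x y / x < y}) /\ forall v, B v = A (emb f v).

Lemma ord_homo_inj (m n : nat) (f : 'I_m -> 'I_n) :
  {homo f : x y / x < y} -> injective f.
Proof.
move=> hf x y exy; apply: val_inj.
by case: (ltngtP x y) => // /hf; rewrite exy ltnn.
Qed.

Lemma ord_homo_id (m : nat) (f : 'I_m -> 'I_m) (x : 'I_m) :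
  {homo f : x y / x < y} -> f x = x.
Proof.
move=> hf.
have ge (k : nat) (y : 'I_m) : y = k :> nat -> k <= f y.
  elim: k y => [//|k IH] y ey.
  have hk : k < m by have := ltn_ord y; lia.
  have := IH (Ordinal hk) erefl => h.
  have : f (Ordinal hk) < f y by apply: hf => /=; lia.
  lia.
(* The mirror image, counting from the top. *)
have le (k : nat) (y : 'I_m) : m - y = k -> m - f y >= k.
  elim: k y => [//|k IH] y ey.
  have [hk|hk] := ltnP y.+1 m; last by have := ltn_ord (f y); lia.
  have h := IH (Ordinal hk) ltac:(simpl; lia).
  have : f y < f (Ordinal hk) by apply: hf => /=; lia.
  lia.
apply: val_inj; have := ge _ x erefl; have := le _ x erefl.
have := ltn_ord x; have := ltn_ord (f x); rewrite /=; lia.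
Qed.

(** As long as some direction is too long, its embedding misses a value l;
    deleting slice l leaves an embedding into a smaller array. When all sizes
    agree, they agree as functions and the embedding is the identity. *)
Lemma embeds_contains (q d : nat) (n m : 'I_d -> nat) (A : darray q n)
  (B : darray q m) : embeds A B -> contains A B.
Proof.
have [N] := ubnP (\sum_j (n j - m j)).
elim: N n A => // N IH n A ltN [f [hf fB]].
have le_mn j : m j <= n j.
  by have := leq_card (f j) (ord_homo_inj (hf j)); rewrite !card_ord.
have [/existsP[j ltj]|] := boolP [exists j, m j < n j]; last first.
  rewrite negb_exists => /forallP h.
  have e : n = m by apply: functional_extensionality_dep => j; have := h j; have := le_mn j; lia.
  clear IH ltN le_mn h; case: _ / e B f hf fB => B f hf fB.
  have -> : B = A; last by apply: contains_refl.
  apply/ffunP => v; rewrite fB; congr (A _); apply/ffunP => j.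
  by rewrite ffunE ord_homo_id.
have [l hl] : exists l, l \notin codom (f j).
  apply/existsP; rewrite -negb_forall; apply/negP => /forallP h.
  have : #|'I_(n j)| <= #|codom (f j)|.
    by apply: subset_leq_card; apply/fintype.subsetP => l _; apply: h.
  move=> /leq_trans/(_ (leq_image_card _ _)); rewrite !card_ord; lia.
apply: (contains_restrict (j := j) (l := l)).
have neq x : f j x != l.
  by apply: contra hl => /eqP <-; apply: codom_f.
have hlt i (x : 'I_(m i)) :
  (if i == j then unbump l (f i x) else f i x) < restrict_size n j i.
  rewrite /restrict_size; case: eqP => // e; subst i.
  have := ltn_ord (f j x); have := ltn_ord l; have /eqP := neq x.
  rewrite /unbump => h1 h2 h3; have := contra_not (@val_inj _ _ _ (f j x) l) h1 => /=.
  by case: ltnP; lia.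
pose g i x : 'I_(restrict_size n j i) := Ordinal (hlt i x).
apply: IH.
  rewrite (bigD1 j) //= /restrict_size eqxx.
  move: ltN; rewrite (bigD1 j) //= => ltN.
  rewrite (eq_bigr (fun i => n i - m i)); last by move=> i /negPf ->.
  lia.
exists g; split.
  move=> i x y xy /=; have := hf i x y xy; case: eqP => // e; subst i.
  have := neq x; have := neq y; rewrite -!val_eqE /= /unbump.
  case: (ltnP l (f j x)); case: (ltnP l (f j y)); lia.
move=> v; rewrite fB /restrict ffunE; congr (A _); apply/ffunP => i.
apply: val_inj; rewrite !ffunE /=; case: eqP => // e; subst i.
by rewrite unbumpKcond val_eqE (negPf (neq _)).
Qed.

Lemma contains_embeds (q d : nat) (n m : 'I_d -> nat) (A : darray q n)
  (B : darray q m) : contains A B -> embeds A B.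
Proof.
elim=> {n m A B} [n A | n m A B j l _ [f [hf fB]]].
  exists (fun j => id); split => [j x y //|v]; congr (A _).
  by apply/ffunP => j; rewrite ffunE.
exists (fun i x => Ordinal (restrict_index_subproof l (f i x))); split.
  move=> i x y /hf /=; case: eqP => // _; rewrite /bump.
  case: (leqP l (f i x)); case: (leqP l (f i y)); lia.
move=> v; rewrite fB ffunE; congr (A _); apply/ffunP => i.
by rewrite !ffunE.
Qed.

(** * The counting bound *)

Lemma card_family_prod (aT : finType) (rT : aT -> finType)
    (F : forall x, pred (rT x)) :
  #|(family F : simpl_pred {dffun forall x : aT, rT x})| = \prod_x #|F x|.
Proof. by rewrite card_family foldrE big_map big_enum. Qed.

Lemma card_cells (d k : nat) : #|{dffun forall j : 'I_d, 'I_k}| = k ^ d.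
Proof. by rewrite card_ffun !card_ord. Qed.

(** A subarray is determined by the increasing tuples of coordinates that it
    keeps, one tuple for each direction. *)
Lemma has_universal_bin (d q k n : nat) : 0 < k ->
  has_universal d q k n -> q ^ (k ^ d) <= 'C(n, k) ^ d.
Proof.
move=> k0 [A uA].
pose srt := [set t : k.-tuple 'I_n | sorted ltn [seq val i | i <- t]].
pose Phi (t : {ffun 'I_d -> k.-tuple 'I_n}) : darray q (fun _ : 'I_d => k) :=
  [ffun v : {dffun forall j : 'I_d, 'I_k} => A [ffun j => tnth (t j) (v j)]].
have -> : q ^ (k ^ d) = #|{: darray q (fun _ : 'I_d => k)}|.
  by rewrite card_ffun card_ord card_cells.
rewrite -(card_ltn_sorted_tuples k n) -[X in _ ^ X](card_ord d) -card_ffun_on.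
apply: leq_trans (leq_imset_card Phi _); apply: subset_leq_card.
apply/fintype.subsetP => B _.
have [f [hf fB]] : embeds A B.
  by apply: contains_embeds; apply: uA => j; rewrite k0 leqnn.
apply/imsetP; exists [ffun j => [tuple f j i | i < k]].
  apply/ffun_onP => j; rewrite ffunE inE /= -map_comp.
  rewrite (map_comp (fun x => x) _) map_id sorted_map.
  have := iota_ltn_sorted 0 k; rewrite -val_enum_ord sorted_map.
  apply: sub_sorted => x y; exact: hf.
apply/ffunP => v; rewrite fB ffunE; congr (A _); apply/ffunP => j.
by rewrite !ffunE tnth_mktuple.
Qed.

(** A smaller array is a subarray of the array of order k obtained by repeating
    its last slices. *)
Lemma universal_of_embeds (d q k n : nat) (A : darray q (fun _ : 'I_d => n)) :
  (forall B : darray q (fun _ : 'I_d => k), embeds A B) -> universal k A.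
Proof.
move=> hA m B hm; apply: embeds_contains.
have lt_m j x : minn x (m j).-1 < m j by have := hm j; lia.
pose B' : darray q (fun _ : 'I_d => k) :=
  [ffun v : {dffun forall j : 'I_d, 'I_k} => B [ffun j => Ordinal (lt_m j (v j))]].
have [f [hf fB]] := hA B'.
have le_mk j : m j <= k by have := hm j; lia.
exists (fun j x => f j (widen_ord (le_mk j) x)); split.
  by move=> j x y xy; apply: hf.
move=> v; transitivity (B' [ffun j => widen_ord (le_mk j) (v j)]).
  rewrite ffunE; congr (B _); apply/ffunP => j; apply: val_inj.
  rewrite !ffunE /=; have lt := ltn_ord (v j).
  by apply/esym/minn_idPl; rewrite -ltnS (ltn_predK lt).
by rewrite fB; congr (A _); apply/ffunP => j; rewrite !ffunE.
Qed.

(** * Avoiding many cylinders *)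

Definition agree (T : finType) (q : nat) (C : {set T}) (g : T -> 'I_q) :
    {set {ffun T -> 'I_q}} :=
  [set w : {ffun T -> 'I_q} | [forall x in C, w x == g x]].

Definition avoid (T I : finType) (q : nat) (C : I -> {set T}) (g : I -> T -> 'I_q)
    (S : {set I}) : {set {ffun T -> 'I_q}} :=
  [set w | [forall i in S, w \notin agree (C i) (g i)]].

Definition meeting (T I : finType) (C : I -> {set T}) (i : I) : {set I} :=
  [set j | ~~ [disjoint C i & C j]].

Lemma agreeP (T : finType) (q : nat) (C : {set T}) (g : T -> 'I_q) (w : {ffun T -> 'I_q}) :
  reflect {in C, forall x, w x = g x} (w \in agree C g).
Proof. by rewrite inE; apply: (iffP forall_inP) => h x /h /eqP. Qed.

Lemma avoidP (T I : finType) (q : nat) (C : I -> {set T}) (g : I -> T -> 'I_q)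
    (S : {set I}) (w : {ffun T -> 'I_q}) :
  reflect {in S, forall i, w \notin agree (C i) (g i)} (w \in avoid C g S).
Proof. by rewrite inE; apply: (iffP forall_inP). Qed.

(** Independence, in counting form: overwriting the cells of C by g maps N onto
    the members of N that agree with g, and all fibres have q ^ #|C| elements. *)
Lemma card_agree_independent (T : finType) (q : nat) (C : {set T}) (g : T -> 'I_q)
    (N : {set {ffun T -> 'I_q}}) :
  (forall w w' : {ffun T -> 'I_q}, {in ~: C, w =1 w'} -> w \in N -> w' \in N) ->
  #|agree C g :&: N| * q ^ #|C| = #|N|.
Proof.
move=> locN.
pose p (w : {ffun T -> 'I_q}) := [ffun x => if x \in C then g x else w x].
have pN w : w \in N -> p w \in agree C g :&: N.
  move=> wN; rewrite inE; apply/andP; split.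
    by apply/agreeP => x xC; rewrite ffunE xC.
  by apply: locN wN => x; rewrite inE ffunE => /negPf ->.
rewrite -[RHS]sum1_card (partition_big p (mem (agree C g :&: N))) //=.
rewrite -sum_nat_const; apply: eq_bigr => w0; rewrite inE => /andP[/agreeP ag0 N0].
rewrite sum1dep_card.
transitivity #|family (fun x : T => [pred y : 'I_q | (x \in C) || (y == w0 x)])|.
  rewrite card_family_prod (bigID (mem C)) /=.
  rewrite (eq_bigr (fun=> q)); last first.
    by move=> x xC; rewrite -[RHS]card_ord; apply: eq_card => y; rewrite !inE xC.
  rewrite prod_nat_const big1 ?muln1 // => x /negPf xC.
  by rewrite -(card1 (w0 x)); apply: eq_card => y; rewrite !inE xC.
apply: eq_card => w; rewrite inE; apply/familyP/andP => [h|[wN /eqP <-] x].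
  split; last first.
    apply/eqP/ffunP => x; rewrite ffunE; have := h x; rewrite inE.
    by case: ifP => [xC _|_ /eqP //]; rewrite ag0.
  by apply: locN N0 => x; have := h x; rewrite !inE => + /negPf xC; rewrite xC => /eqP.
by rewrite inE ffunE; case: ifP => //=.
Qed.

Lemma avoid_sub (T I : finType) (q : nat) (C : I -> {set T}) (g : I -> T -> 'I_q)
  (S S' : {set I}) : S' \subset S -> avoid C g S \subset avoid C g S'.
Proof.
move=> /fintype.subsetP sub; apply/fintype.subsetP => w /avoidP h.
by apply/avoidP => i /sub; apply: h.
Qed.

Lemma card_agree_avoid (T I : finType) (q : nat) (C : I -> {set T})
    (g : I -> T -> 'I_q) (D : {set T}) (h : T -> 'I_q) (S : {set I}) :
  {in S, forall j, [disjoint D & C j]} ->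
  #|agree D h :&: avoid C g S| * q ^ #|D| = #|avoid C g S|.
Proof.
move=> disj; apply: card_agree_independent => w w' eqw /avoidP wS.
apply/avoidP => j jS; apply: contra (wS j jS) => /agreeP w'j.
apply/agreeP => x xj; rewrite eqw ?w'j // inE; apply/negP => xD.
by rewrite (disjointFr (disj j jS) xD) in xj.
Qed.

(** The union bound behind both steps of the avoidance argument: whatever avoids
    the smaller family S :\: G but not S agrees with some pattern in S :&: G. *)
Lemma avoid_union (T I : finType) (q : nat) (C : I -> {set T})
    (g : I -> T -> 'I_q) (E : {set {ffun T -> 'I_q}}) (S G : {set I}) :
  #|E :&: avoid C g (S :\: G)| <=
    #|E :&: avoid C g S| +
    \sum_(j in S :&: G) #|E :&: agree (C j) (g j) :&: avoid C g (S :\: G)|.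
Proof.
pose U := \bigcup_(j in S :&: G) (E :&: agree (C j) (g j) :&: avoid C g (S :\: G)).
apply: (@leq_trans #|(E :&: avoid C g S) :|: U|).
  apply: subset_leq_card; apply/fintype.subsetP => w.
  rewrite finset.in_setI => /andP[wE wSG]; rewrite finset.in_setU finset.in_setI wE /=.
  case: (boolP (w \in avoid C g S)) => //= wS.
  have [j [jS wj]] : exists j, j \in S /\ w \in agree (C j) (g j).
    apply: contrapT => h; apply: (negP wS); apply/avoidP => j jS.
    by apply/negP => wj; apply: h; exists j.
  apply/bigcupP; exists j; last by rewrite finset.in_setI finset.in_setI wE wj wSG.
  rewrite inE jS /=; apply: contraT => jG.
  by move: (avoidP _ _ _ _ wSG j); rewrite finset.in_setD jG jS wj => /(_ isT).
apply: leq_trans (leq_card_setU _ _) _; rewrite leq_add2l.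
rewrite /U; elim/big_rec2: _ => [|j a b _ h]; first by rewrite cards0.
by apply: leq_trans (leq_card_setU _ _) _; rewrite leq_add2l.
Qed.

(** This replaces a correlation inequality: forgetting the events whose cells
    meet those of i at most doubles the number of avoiding words. An event j that
    is put back is independent of the part of S' that does not meet j, and by
    induction that part costs a factor at most 2; as at most q ^ c / 4 events meet
    i, they remove together at most half of the words avoiding S'. *)
Lemma avoid_remove_meeting (T I : finType) (q c : nat) (C : I -> {set T})
    (g : I -> T -> 'I_q) (S0 : {set I}) :
  0 < q -> {in S0, forall i, #|C i| = c} ->
  {in S0, forall i, 4 * #|S0 :&: meeting C i| <= q ^ c} ->
  forall S : {set I}, S \subset S0 -> {in S0, forall i,
    #|avoid C g (S :\: meeting C i)| <= 2 * #|avoid C g S|}.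
Proof.
move=> q0 hc hG S; have [m] := ubnP #|S|; elim: m S => // m IH S ltS sS i iS0.
set S' := S :\: meeting C i.
have [/eqP e|[j0 j0S]] := set_0Vmem (S :&: meeting C i).
  have -> : S' = S by apply/finset.setDidPl; rewrite -finset.setI_eq0.
  by rewrite leq_pmull.
have ltS' : #|S'| < m.
  apply: leq_trans (_ : #|S| <= m); last by rewrite -ltnS.
  apply: proper_card; rewrite finset.properEneq finset.subsetDl andbT.
  apply/negP => /eqP e; move: j0S; rewrite finset.in_setI -e /S'.
  by rewrite finset.in_setD; case: (_ \in meeting _ _); rewrite ?andbF.
have sS' : S' \subset S0 by apply: fintype.subset_trans (finset.subsetDl _ _) sS.
have X j : j \in S :&: meeting C i ->
    q ^ c * #|agree (C j) (g j) :&: avoid C g S'| <= 2 * #|avoid C g S'|.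
  move=> jS; have jS0 : j \in S0.
    by apply: (fintype.subsetP sS); move: jS; rewrite finset.in_setI => /andP[].
  apply: leq_trans (IH S' ltS' sS' j jS0); rewrite mulnC -(hc j jS0).
  rewrite -(@card_agree_avoid _ _ _ C g (C j) (g j)); last first.
    by move=> l; rewrite finset.in_setD !inE negbK => /andP[].
  rewrite leq_mul2r; apply/orP; right; apply: subset_leq_card.
  by apply: finset.setIS; apply: avoid_sub; apply: finset.subsetDl.
have := avoid_union C g [set: {ffun T -> 'I_q}] S (meeting C i).
rewrite !finset.setTI -/S' => h.
have h1 : q ^ c * #|avoid C g S'| <=
    q ^ c * #|avoid C g S| + #|S0 :&: meeting C i| * (2 * #|avoid C g S'|).
  apply: leq_trans (leq_mul (leqnn (q ^ c)) h) _.
  rewrite mulnDr leq_add2l big_distrr /=.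
  apply: (@leq_trans (\sum_(j in S :&: meeting C i) 2 * #|avoid C g S'|)).
    by apply: leq_sum => j jS; rewrite finset.setTI; apply: X.
  rewrite sum_nat_const leq_mul2r; apply/orP; right; apply: subset_leq_card.
  exact: finset.setSI.
have hGi := hG i iS0.
have qc0 : 0 < q ^ c by rewrite expn_gt0 q0.
rewrite -(leq_pmul2l qc0); nia.
Qed.

(** Two patterns that contradict each other on a common cell are never both
    present, and otherwise they combine into one pattern on the union; this is why
    only an inequality holds. *)
Lemma card_agree2 (T I : finType) (q : nat) (C : I -> {set T})
    (g : I -> T -> 'I_q) (i j : I) (S : {set I}) :
  {in S, forall l, [disjoint C i & C l]} -> {in S, forall l, [disjoint C j & C l]} ->
  #|agree (C i) (g i) :&: agree (C j) (g j) :&: avoid C g S| * q ^ #|C i :|: C j|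
    <= #|avoid C g S|.
Proof.
move=> di dj; pose h x := if x \in C i then g i x else g j x.
rewrite -(@card_agree_avoid _ _ _ C g (C i :|: C j) h); last first.
  move=> l lS; rewrite finset.disjoints_subset finset.subUset -!finset.disjoints_subset.
  by rewrite di ?dj.
rewrite leq_mul2r; apply/orP; right; apply: subset_leq_card; apply: finset.setSI.
apply/fintype.subsetP => w; rewrite finset.in_setI => /andP[/agreeP wi /agreeP wj].
apply/agreeP => x; rewrite finset.in_setU /h; case: ifP => [xi _|_ /= xj].
  exact: wi.
exact: wj.
Qed.

(** Among the words avoiding S, at least the fraction q ^ (- c) / 2 shows pattern
    i. On S', the events of S that do not meet i, pattern i is independent of the
    rest and has frequency q ^ (- c). Returning to S loses the words that show i
    and some j meeting i; relative to the words avoiding S', their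
    frequency is at most twice that of the two patterns together, and the
    hypothesis on overlaps limits the total loss to half. *)
Lemma avoid_step (T I : finType) (q c : nat) (C : I -> {set T})
    (g : I -> T -> 'I_q) (S0 : {set I}) :
  0 < q -> {in S0, forall i, #|C i| = c} -> 8 <= q ^ c ->
  {in S0, forall i,
    8 * \sum_(j in S0 :&: meeting C i | j != i) q ^ #|C i :&: C j| <= q ^ c} ->
  forall (S : {set I}) i, S \subset S0 -> i \in S0 -> i \notin S ->
    2 * q ^ c * #|avoid C g (i |: S)| + #|avoid C g S| <= 2 * q ^ c * #|avoid C g S|.
Proof.
move=> q0 hc q8 hD S i sS iS0 niS.
have hG : {in S0, forall i, 4 * #|S0 :&: meeting C i| <= q ^ c}.
  move=> l lS0; have := hD l lS0.
  have : #|(S0 :&: meeting C l) :\ l| <=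
      \sum_(j in S0 :&: meeting C l | j != l) q ^ #|C l :&: C j|.
    rewrite -sum1_card (eq_bigl (fun j => (j \in S0 :&: meeting C l) && (j != l))).
      by apply: leq_sum => j _; rewrite expn_gt0 q0.
    by move=> j; rewrite !inE andbC.
  have : #|S0 :&: meeting C l| <= (#|(S0 :&: meeting C l) :\ l|).+1.
    by rewrite (cardsD1 l (S0 :&: meeting C l)); case: (_ \in _).
  lia.
have rem := avoid_remove_meeting g q0 hc hG.
set S' := S :\: meeting C i.
set a := #|avoid C g S|; set a' := #|avoid C g S'|.
have aa' : a <= a' by apply: subset_leq_card; apply: avoid_sub; apply: finset.subsetDl.
have a'2 : a' <= 2 * a by apply: rem.
pose E := agree (C i) (g i).
have split_a : a = #|avoid C g (i |: S)| + #|E :&: avoid C g S|.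
  rewrite /a -(cardsID E) addnC finset.setIC; congr (_ + _); apply: eq_card => w.
  rewrite finset.in_setD; apply/andP/avoidP => [[wE /avoidP h] j|h].
    by rewrite finset.in_setU1 => /orP[/eqP -> //|]; apply: h.
  split; first by apply: h; rewrite finset.setU11.
  by apply/avoidP => j jS; apply: h; rewrite finset.setU1r.
have eq_E : #|E :&: avoid C g S'| * q ^ c = a'.
  rewrite -(hc i iS0) card_agree_avoid // => l.
  by rewrite finset.in_setD !inE negbK => /andP[].
have X j : j \in S :&: meeting C i ->
    q ^ c * (q ^ c * #|E :&: agree (C j) (g j) :&: avoid C g S'|) <=
      4 * a * q ^ #|C i :&: C j|.
  move=> jS; have jS0 : j \in S0.
    by apply: (fintype.subsetP sS); move: jS; rewrite finset.in_setI => /andP[].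
  have sub : #|E :&: agree (C j) (g j) :&: avoid C g S'| <=
     #|E :&: agree (C j) (g j) :&: avoid C g (S' :\: meeting C j)|.
    by apply: subset_leq_card; apply: finset.setIS; apply: avoid_sub; apply: finset.subsetDl.
  have le2 : #|E :&: agree (C j) (g j) :&: avoid C g (S' :\: meeting C j)|
       * q ^ #|C i :|: C j| <= #|avoid C g (S' :\: meeting C j)|.
    apply: card_agree2 => l; rewrite !inE !negbK => /and3P[] //.
  have le3 : #|avoid C g (S' :\: meeting C j)| <= 2 * a'.
    by apply: rem => //; apply: fintype.subset_trans (finset.subsetDl _ _) sS.
  (* Inclusion-exclusion turns the union of the two cell sets into their overlap. *)
  have qq : q ^ c * q ^ c = q ^ #|C i :|: C j| * q ^ #|C i :&: C j|.
    by rewrite -!expnD cardsUI !hc.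
  rewrite mulnA qq mulnAC leq_mul2r; apply/orP; right.
  apply: (@leq_trans (2 * a')); last by lia.
  by apply: leq_trans le3; apply: leq_trans le2; rewrite mulnC leq_mul2r sub orbT.
have := avoid_union C g E S (meeting C i); rewrite -/S'.
set s := \sum_(j in _) _ => h.
have hs : 2 * (q ^ c * s) <= a.
  have h1 : q ^ c * (q ^ c * s) <= 4 * a *
     \sum_(j in S0 :&: meeting C i | j != i) q ^ #|C i :&: C j|.
    rewrite /s !big_distrr /=.
    apply: (@leq_trans (\sum_(j in S :&: meeting C i) 4 * a * q ^ #|C i :&: C j|)).
      by apply: leq_sum => j jS; apply: X.
    rewrite [X in _ <= X](bigID (fun j => j \in S :&: meeting C i)) /=.
    apply: leq_trans (leq_addr _ _).
    rewrite [X in _ <= X](eq_bigl (fun j => j \in S :&: meeting C i)) //= => j.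
    apply/idP/idP => [/andP[] //|jS]; apply/andP; split => //.
    move: jS; rewrite !finset.in_setI => /andP[jS ->].
    rewrite (fintype.subsetP sS j jS) /=.
    by apply/eqP => e; move: niS; rewrite -e jS.
  have qc0 : 0 < q ^ c by rewrite expn_gt0 q0.
  have := hD i iS0; rewrite -(leq_pmul2l qc0); nia.
have := leq_mul (leqnn (q ^ c)) h; nia.
Qed.

Lemma card_avoid (T I : finType) (q c : nat) (C : I -> {set T})
    (g : I -> T -> 'I_q) (S0 : {set I}) :
  0 < q -> {in S0, forall i, #|C i| = c} -> 8 <= q ^ c ->
  {in S0, forall i,
    8 * \sum_(j in S0 :&: meeting C i | j != i) q ^ #|C i :&: C j| <= q ^ c} ->
  (2 * q ^ c) ^ #|S0| * #|avoid C g S0| <= (2 * q ^ c).-1 ^ #|S0| * q ^ #|T|.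
Proof.
move=> q0 hc q8 hD.
suff h m (S : {set I}) : #|S| = m -> S \subset S0 ->
    (2 * q ^ c) ^ m * #|avoid C g S| <= (2 * q ^ c).-1 ^ m * q ^ #|T| by exact: h.
elim: m S => [|m IH] S eS sS.
  by rewrite !mul1n (leq_trans (max_card _)) // card_ffun card_ord.
have [i iS] : exists i, i \in S by apply/set0Pn; rewrite -card_gt0 eS.
have sS' : S :\ i \subset S0 by apply: fintype.subset_trans sS; apply: finset.subsetDl.
have cS' : #|S :\ i| = m by move: eS; rewrite (cardsD1 i) iS => -[].
have niS : i \notin S :\ i by rewrite !inE eqxx.
have := avoid_step g q0 hc q8 hD sS' (fintype.subsetP sS i iS) niS.
rewrite finset.setD1K // => step; have := IH _ cS' sS' => IHm.
set b := #|avoid C g S| in step *; set b' := #|avoid C g (S :\ i)| in step IHm.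
have step' : 2 * q ^ c * b <= (2 * q ^ c).-1 * b' by rewrite -subn1 mulnBl; lia.
rewrite !expnS -!mulnA [2 * _]mulnA mulnCA.
apply: leq_trans (leq_mul (leqnn _) step') _.
by rewrite mulnCA leq_mul2l IHm orbT.
Qed.

(** * Boxes and the random array *)

Definition box (d n : nat) (I : {ffun 'I_d -> {set 'I_n}}) :
    {set {dffun forall j : 'I_d, 'I_n}} :=
  [set x : {dffun forall j : 'I_d, 'I_n} | [forall j, x j \in I j]].

Definition ksets (d n k : nat) : {set {ffun 'I_d -> {set 'I_n}}} :=
  [set I : {ffun 'I_d -> {set 'I_n}} | [forall j, #|I j| == k]].

(** The pattern that B prescribes on the box of I: the j-th coordinate of a cell
    is replaced by its rank in I j. Reducing the rank modulo k only serves to have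
    a value in 'I_k outside the box too. *)
Definition pattern (d q k n : nat) (k0 : 0 < k) (B : darray q (fun _ : 'I_d => k))
    (I : {ffun 'I_d -> {set 'I_n}}) (x : {dffun forall j : 'I_d, 'I_n}) : 'I_q :=
  B [ffun j => Ordinal (ltn_pmod (index (x j) (enum (I j))) k0)].

Lemma card_box (d n : nat) (I : {ffun 'I_d -> {set 'I_n}}) :
  #|box I| = \prod_j #|I j|.
Proof.
rewrite -(@card_family_prod _ (fun=> 'I_n) (fun j => mem (I j))).
by apply: eq_card => x; rewrite inE; apply/forallP/familyP.
Qed.

Lemma boxI (d n : nat) (I J : {ffun 'I_d -> {set 'I_n}}) :
  box I :&: box J = box [ffun j => I j :&: J j].
Proof.
apply/setP => x; rewrite !inE; apply/andP/forallP => [[/forallP hI /forallP hJ] j|h].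
  by rewrite ffunE inE hI hJ.
by split; apply/forallP => j; have := h j; rewrite ffunE inE => /andP[].
Qed.

Lemma card_ksets (d n k : nat) : #|ksets d n k| = 'C(n, k) ^ d.
Proof.
rewrite -[X in 'C(X, _)]card_ord -card_draws -[X in _ ^ X](card_ord d) -card_ffun_on.
apply: eq_card => I; rewrite inE; apply/forallP/ffun_onP => h j; have := h j;
  by rewrite inE.
Qed.

Lemma agree_pattern_embeds (d q k n : nat) (k0 : 0 < k)
    (B : darray q (fun _ : 'I_d => k)) (I : {ffun 'I_d -> {set 'I_n}})
    (A : darray q (fun _ : 'I_d => n)) :
  I \in ksets d n k -> A \in agree (box I) (pattern k0 B I) -> embeds A B.
Proof.
rewrite inE => /forallP cI /agreeP agA.
have cE j : k = #|I j| by apply/esym/eqP.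
exists (fun j x => enum_val (cast_ord (cE j) x)); split.
  move=> j x y xy; pose x0 := enum_val (cast_ord (cE j) x).
  have srt : sorted ltn [seq val i | i <- enum (I j)].
    rewrite sorted_map {1}/(enum _); apply: sorted_filter.
      by move=> a b c; exact: ltn_trans.
    rewrite -enumT -sorted_map val_enum_ord; exact: iota_ltn_sorted.
  rewrite !(enum_val_nth x0).
  rewrite -!(nth_map x0 0 val) -?cardE ?ltn_ord //.
  by apply: (sorted_ltn_nth ltn_trans 0 srt); rewrite ?inE ?size_map -?cardE ?ltn_ord.
move=> v; rewrite agA; last first.
  by rewrite inE; apply/forallP => j; rewrite ffunE; apply: enum_valP.
rewrite /pattern; congr (B _); apply/ffunP => j; apply: val_inj.
rewrite !ffunE /= (enum_val_nth (enum_val (cast_ord (cE j) (v j)))).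
by rewrite index_uniq ?enum_uniq -?cardE ?ltn_ord //= modn_small.
Qed.

(** If no array were universal, then each array would avoid all copies of some B,
    so that the words avoiding the patterns of the various B would cover all
    arrays; the last hypothesis says that they are too few for this. *)
Lemma has_universal_of_overlap (d q k n : nat) : 0 < k -> 0 < q -> 8 <= q ^ (k ^ d) ->
  {in ksets d n k, forall I,
     8 * \sum_(J in ksets d n k :&: meeting (@box d n) I | J != I)
         q ^ #|box I :&: box J| <= q ^ (k ^ d)} ->
  q ^ (k ^ d) * (2 * q ^ (k ^ d)).-1 ^ ('C(n, k) ^ d) <
    (2 * q ^ (k ^ d)) ^ ('C(n, k) ^ d) ->
  has_universal d q k n.
Proof.
move=> k0 q0 q8 hD lt; apply: contrapT => no.
have bad (A : darray q (fun _ : 'I_d => n)) :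
    exists B, A \in avoid (@box d n) (@pattern d q k n k0 B) (ksets d n k).
  apply: contrapT => h; apply: no; exists A; apply: universal_of_embeds => B.
  apply: contrapT => nB; apply: h; exists B; apply/avoidP => I IS.
  by apply/negP => /(agree_pattern_embeds IS).
pose U := \bigcup_(B : darray q (fun _ : 'I_d => k))
   avoid (@box d n) (@pattern d q k n k0 B) (ksets d n k).
have leU : q ^ #|{dffun forall j : 'I_d, 'I_n}| <= #|U|.
  have -> : q ^ #|{dffun forall j : 'I_d, 'I_n}| = #|{: darray q (fun _ : 'I_d => n)}|.
    by rewrite [RHS]card_ffun card_ord.
  apply: subset_leq_card; apply/fintype.subsetP => A _.
  by have [B hB] := bad A; apply/bigcupP; exists B.
have leU2 : #|U| <= \sum_(B : darray q (fun _ : 'I_d => k))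
   #|avoid (@box d n) (@pattern d q k n k0 B) (ksets d n k)|.
  rewrite /U; elim/big_rec2: _ => [|j a b _ h]; first by rewrite cards0.
  by apply: leq_trans (leq_card_setU _ _) _; rewrite leq_add2l.
have cbox : {in ksets d n k, forall I, #|box I| = k ^ d}.
  move=> I; rewrite inE => /forallP cI; rewrite card_box.
  by rewrite (eq_bigr (fun=> k)) ?prod_nat_const ?card_ord // => j _; apply/eqP.
set N := 'C(n, k) ^ d in lt *; set X := 2 * q ^ (k ^ d) in lt *.
set t := #|{dffun forall j : 'I_d, 'I_n}| in leU *.
have X0 : 0 < X ^ N by rewrite expn_gt0 muln_gt0 expn_gt0 q0.
have key : X ^ N * q ^ t <= q ^ (k ^ d) * (X.-1 ^ N * q ^ t).
  apply: leq_trans (leq_mul (leqnn _) (leq_trans leU leU2)) _.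
  rewrite big_distrr /=.
  have -> : q ^ (k ^ d) = #|{: darray q (fun _ : 'I_d => k)}|.
    by rewrite card_ffun card_ord card_cells.
  rewrite -sum_nat_const; apply: leq_sum => B _.
  have := card_avoid (@pattern d q k n k0 B) q0 cbox q8 hD.
  by rewrite card_ksets.
move: key; rewrite mulnA leq_pmul2r ?expn_gt0 ?q0 // leqNgt.
by rewrite lt.
Qed.

(** * Overlaps of boxes *)

(** B is recovered from A :&: B and B :\: A; forgetting that the latter avoids A
    replaces C(n-k, k-s) by C(n, k-s), which is harmless. *)
Lemma card_ksets_meet (n k s : nat) (A : {set 'I_n}) : #|A| = k ->
  #|[set B : {set 'I_n} | (#|B| == k) && (#|A :&: B| == s)]| <= 'C(k, s) * 'C(n, k - s).
Proof.
move=> cA.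
rewrite -[X in 'C(X, s)]cA -cards_draws -[X in 'C(X, _)]card_ord -card_draws -cardsX.
pose f (B : {set 'I_n}) := (A :&: B, B :\: A).
rewrite -(@card_in_imset _ _ f); last first.
  move=> B B' _ _ [e1 e2].
  by rewrite -(finset.setID B A) -(finset.setID B' A) e2 finset.setIC e1 finset.setIC.
apply: subset_leq_card; apply/fintype.subsetP => _ /imsetP[B + ->].
rewrite inE => /andP[/eqP cB /eqP cI].
rewrite inE !inE /= finset.subsetIl cI eqxx /=.
by have := cardsID A B; rewrite finset.setIC cB cI => <-; rewrite addKn.
Qed.

(** If the boxes meet then all s j = #|I j :&: J j| are positive, and J <> I excludes
    that they are all equal to k. *)
Lemma overlap_sum_le (d q k n t : nat) (I : {ffun 'I_d -> {set 'I_n}}) :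
  I \in ksets d n k ->
  (forall s : 'I_d -> nat, (forall j, 0 < s j <= k) -> (exists j, s j < k) ->
     (\prod_j ('C(k, s j) * 'C(n, k - s j))) * q ^ (\prod_j s j) <= t) ->
  \sum_(J in ksets d n k :&: meeting (@box d n) I | J != I) q ^ #|box I :&: box J|
    <= k.+1 ^ d * t.
Proof.
rewrite inE => /forallP cI ht.
pose sg (J : {ffun 'I_d -> {set 'I_n}}) : {ffun 'I_d -> 'I_k.+1} :=
  [ffun j => inord #|I j :&: J j|].
have sgE J j : sg J j = #|I j :&: J j| :> nat.
  rewrite ffunE inordK // ltnS -(eqP (cI j)); apply: subset_leq_card.
  exact: finset.subsetIl.
pose P (s : {ffun 'I_d -> 'I_k.+1}) := [forall j, 0 < s j] && [exists j, s j < k].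
have boxE J : #|box I :&: box J| = \prod_j sg J j.
  by rewrite boxI card_box; apply: eq_bigr => j _; rewrite ffunE sgE.
rewrite (partition_big sg P) /=; last first.
  move=> J /andP[]; rewrite !inE => /andP[/forallP cJ meet] neq.
  apply/andP; split.
    apply/forallP => j; rewrite sgE; move: meet; rewrite -finset.setI_eq0.
    case/set0Pn => x; rewrite inE => /andP[]; rewrite !inE => /forallP xI /forallP xJ.
    by rewrite card_gt0; apply/set0Pn; exists (x j); rewrite inE xI xJ.
  apply: contraT; rewrite negb_exists => /forallP h.
  case/eqP: neq; apply/ffunP => j; have := h j; rewrite sgE -leqNgt => hj.
  have e1 : I j :&: J j = I j.
    by apply/eqP; rewrite eqEcard finset.subsetIl (eqP (cI j)).
  have e2 : I j :&: J j = J j.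
    by apply/eqP; rewrite eqEcard finset.subsetIr (eqP (cJ j)).
  by rewrite -e2.
apply: (@leq_trans (\sum_(s | P s) t)); last first.
  rewrite sum_nat_const leq_mul2r; apply/orP; right.
  by apply: leq_trans (max_card _) _; rewrite card_ffun !card_ord.
apply: leq_sum => s /andP[/forallP s0 /existsP[j0 sj0]].
apply: leq_trans (ht (fun j => s j) _ _); last by exists j0.
  apply: (@leq_trans (\sum_(J in family (fun j =>
      [set B : {set 'I_n} | (#|B| == k) && (#|I j :&: B| == s j)])) q ^ \prod_j s j)).
    rewrite (eq_bigr (fun=> q ^ \prod_j s j)); last first.
      by move=> J /andP[_ /eqP <-]; rewrite boxE.
    rewrite !big_const !iter_addn_0 leq_mul2l; apply/orP; right.
    apply: subset_leq_card; apply/fintype.subsetP => J.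
    rewrite unfold_in => /andP[/andP[+ _] /eqP e].
    rewrite inE => /andP[+ _]; rewrite inE => /forallP cJ.
    by apply/familyP => j; rewrite inE cJ -e sgE /=.
  rewrite big_const iter_addn_0 mulnC leq_mul2r; apply/orP; right.
  rewrite (@card_family_prod _ (fun=> {set 'I_n})).
  by apply: leq_prod => j _; apply: card_ksets_meet; apply/eqP.
by move=> j; rewrite s0 -ltnS ltn_ord.
Qed.

(** * Bounds on binomials and overlap terms *)

Lemma bin_le_exp (n m : nat) : 'C(n, m) <= n ^ m.
Proof.
elim: m => [|m IH]; first by rewrite bin0.
apply: (@leq_trans (m.+1 * 'C(n, m.+1))); first by rewrite leq_pmull.
rewrite mul_bin_left expnS; apply: leq_mul => //; exact: leq_subr.
Qed.

Lemma bin_sub_mul_le (n k s : nat) : s <= k -> k <= n ->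
  'C(n, k - s) * (n - k) ^ s <= k ^ s * 'C(n, k).
Proof.
elim: s => [|s IH] sk kn; first by rewrite subn0 muln1 mul1n.
have {IH} := IH (ltnW sk) kn.
have ->: k - s = (k - s.+1).+1 by lia.
set m := k - s.+1 => IH.
have h := mul_bin_left n m.
have h1 : 'C(n, m) * (n - k) <= k * 'C(n, m.+1).
  apply: (@leq_trans ((n - m) * 'C(n, m))).
    by rewrite mulnC leq_mul2r; apply/orP; right; rewrite /m; lia.
  by rewrite -h leq_mul2r; apply/orP; right; rewrite /m; lia.
rewrite !expnS mulnA.
apply: leq_trans (leq_mul h1 (leqnn _)) _.
by rewrite -!mulnA leq_mul2l IH orbT.
Qed.

(** A random k-subset meets a fixed one in s elements with probability at most
    about (k ^ 2 / n) ^ s: prescribing s elements costs (k/n) ^ s, and there are at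
    most k ^ s choices. *)
Lemma bin_overlap_le (n k s : nat) : s <= k -> 2 * k <= n ->
  'C(k, s) * 'C(n, k - s) * n ^ s <= (2 * k ^ 2) ^ s * 'C(n, k).
Proof.
move=> sk kn.
have h1 : n ^ s <= 2 ^ s * (n - k) ^ s.
  by rewrite -expnMn; case: s {sk} => // s; rewrite leq_exp2r //; lia.
have h2 : 'C(n, k - s) * (n - k) ^ s <= k ^ s * 'C(n, k).
  by apply: bin_sub_mul_le => //; lia.
have h3 := bin_le_exp k s.
apply: leq_trans (leq_mul (leqnn _) h1) _.
have -> : (2 * k ^ 2) ^ s = k ^ s * k ^ s * 2 ^ s.
  by rewrite -!expnMn mulnC.
have := leq_mul (leq_mul h3 h2) (leqnn (2 ^ s)); lia.
Qed.

Local Open Scope ring_scope.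

Lemma prod_le_mean (R : realType) (d : nat) (s : 'I_d -> nat) :
  (\prod_j s j)%:R <= ((\sum_j s j)%:R / d%:R) ^+ d :> R.
Proof.
rewrite natr_prod natr_sum.
have := @leif_AGM R 'I_d predT (fun j => (s j)%:R) => /=.
rewrite card_ord => h; have [] // := h (fun j _ => ler0n _ _).
Qed.

(** Here x is the square root of Q = q ^ (k ^ (d-1) / d), and n is Q up to a
    polynomial in k. Let a be the mean of the s j. If a <= k/2, then
    prod s_j <= a ^ d <= (sum s_j) k ^ (d-1) / (2 d), so that q ^ (prod s_j) is at
    most x ^ (sum s_j), while n ^ (sum s_j) >= x ^ (2 sum s_j). If a > k/2, let T
    be the sum of the k - s_j; then k ^ d - prod s_j >= 3 T k ^ (d-1) / (2 d), so
    that the loss x ^ (3 T) beats the at most (k n) ^ T choices. *)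
Lemma overlap_term_le (R : realType) (d q k n : nat) (s : 'I_d -> nat) (mu x : R) :
  (2 <= d)%N -> (2 <= q)%N -> (forall j, (0 < s j <= k)%N) -> (exists j, (s j < k)%N) ->
  (2 * k <= n)%N -> x = q%:R `^ (k%:R ^+ (d - 1) / (2 * d%:R)) ->
  x ^+ 2 <= n%:R <= k%:R * x ^+ 2 -> ('C(n, k) ^ d)%:R <= mu * q%:R ^+ (k ^ d) ->
  1 <= mu -> 2 * k%:R ^+ 2 <= x ->
  ((\prod_j ('C(k, s j) * 'C(n, k - s j)))%N * q ^ (\prod_j s j)%N)%:R
    <= 2 * k%:R ^+ 2 * mu / x * q%:R ^+ (k ^ d).
Proof.
move=> hd hq hs [j0 sj0] kn xE /andP[xn nx] hmu mu1 hx.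
set sg := (\sum_j s j)%N; set P := (\prod_j _)%N; set Pi := (\prod_j s j)%N.
have q0 : 0 < q%:R :> R by rewrite ltr0n; lia.
have q1 : 1 <= q%:R :> R by rewrite ler1n; lia.
have d0 : 0 < d%:R :> R by rewrite ltr0n; lia.
have x0 : 0 < x by rewrite xE powR_gt0.
have k0 : 0 < k%:R :> R by rewrite ltr0n; have := hs j0; lia.
set K := k%:R : R in k0 hx xE nx *.
pose a := sg%:R / d%:R : R.
have sgE : sg%:R = a * d%:R :> R by rewrite /a divfK // gt_eqF.
have hPi : Pi%:R <= a ^+ d by apply: prod_le_mean.
have a0 : 0 <= a by rewrite divr_ge0.
have sg_le : (sg <= d * k)%N.
  rewrite -[X in (_ <= X * _)%N]card_ord -sum_nat_const; apply: leq_sum => j _.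
  by have /andP[] := hs j.
have aK : a <= K by rewrite /a ler_pdivrMr // -natrM ler_nat mulnC.
have lerX (u v : R) m : 0 <= u -> u <= v -> u ^+ m <= v ^+ m.
  by move=> u0 uv; apply: lerXn2r; rewrite ?nnegrE // (le_trans u0).
clearbody a.
have xpow m : x ^+ m = q%:R `^ (m%:R * (K ^+ (d - 1) / (2 * d%:R))).
  by rewrite xE -powR_mulrn ?powR_ge0 // -powRrM mulrC.
have qpow m : q%:R ^+ m = q%:R `^ m%:R :> R by rewrite powR_mulrn // ltW.
have kdE : (k ^ d)%:R = K * K * K ^+ (d - 2) :> R.
  by rewrite natrX -/K -{1}(subnKC hd) exprD expr2.
have d1E : K ^+ (d - 1) = K * K ^+ (d - 2).
  by rewrite -exprS -subSn.
have Kd2 : 0 < K ^+ (d - 2) by rewrite exprn_gt0.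
have Q0 : 0 < q%:R ^+ (k ^ d) :> R by rewrite exprn_gt0.
have y0 : 0 <= 2 * K ^+ 2 / x by rewrite divr_ge0 ?mulr_ge0 ?exprn_ge0 ?ltW.
have y1 : 2 * K ^+ 2 / x <= 1 by rewrite ler_pdivrMr ?mul1r.
rewrite natrM natrX.
have [aK2|aK2] := leP a (K / 2).
- have h1 : q%:R ^+ Pi <= x ^+ sg.
    rewrite qpow xpow; apply: ler_powR => //; rewrite sgE.
    apply: le_trans hPi _.
    have -> : a * d%:R * (K ^+ (d - 1) / (2 * d%:R)) = a * (K ^+ (d - 1) / 2).
      by field; rewrite gt_eqF.
    have -> : a ^+ d = a * (a * a ^+ (d - 2)) by rewrite -{1}(subnKC hd) exprD expr2 mulrA.
    rewrite ler_wpM2l // d1E mulrAC.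
    by apply: ler_pM; rewrite ?exprn_ge0 //; apply: lerX.
  have h2 : P%:R * x ^+ 2 ^+ sg <= (2 * K ^+ 2) ^+ sg * ('C(n, k) ^ d)%:R.
    apply: (@le_trans _ _ (P%:R * n%:R ^+ sg)).
      by rewrite ler_wpM2l // lerX ?sqr_ge0.
    have hN : (P * n ^ sg <= (2 * k ^ 2) ^ sg * 'C(n, k) ^ d)%N.
      rewrite /P /sg !expn_sum -[X in ('C(_, _) ^ X)%N](card_ord d) -prod_nat_const.
      rewrite -!big_split /=; apply: leq_prod => j _.
      by apply: bin_overlap_le => //; have /andP[] := hs j.
    move: hN; rewrite -(ler_nat R) natrM natrX natrM.
    by rewrite [X in X * ('C(_, _) ^ _)%:R]natrX natrM natrX.
  have sg0 : (0 < sg)%N.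
    have /andP[s0 _] := hs j0; apply: leq_trans s0 _.
    by rewrite /sg (bigD1 j0) //= leq_addr.
  have x2s : x ^+ sg * x ^+ sg = x ^+ 2 ^+ sg by rewrite -exprMn expr2.
  (* The base is at most 1 and the exponent positive. *)
  have h3 : (2 * K ^+ 2 / x) ^+ sg <= 2 * K ^+ 2 / x.
    by rewrite -[leRHS]expr1; apply: ler_wiXn2l.
  have xs0 : 0 < x ^+ sg by rewrite exprn_gt0.
  have h4 : P%:R * x ^+ sg <= (2 * K ^+ 2 / x) ^+ sg * ('C(n, k) ^ d)%:R.
    by rewrite -(ler_pM2r xs0) -[leLHS]mulrA x2s expr_div_n mulrAC divfK ?gt_eqF.
  apply: (@le_trans _ _ (P%:R * x ^+ sg)); first by apply: ler_wpM2l.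
  apply: le_trans h4 _.
  apply: (@le_trans _ _ (2 * K ^+ 2 / x * (mu * q%:R ^+ (k ^ d)))).
    by apply: ler_pM => //; apply: exprn_ge0.
  by rewrite mulrA [2 * _ * mu / x]mulrAC.
- pose T := (\sum_j (k - s j))%N.
  have TE : T%:R = (K - a) * d%:R :> R.
    rewrite mulrBl -sgE -natrM -natrB 1?mulnC //; congr _%:R.
    rewrite /T /sg -[X in (X * _)%N](card_ord d) -sum_nat_const sumnB // => j _.
    by have /andP[] := hs j.
  have T0 : (0 < T)%N by rewrite /T (bigD1 j0) //= addn_gt0 subn_gt0 sj0.
  have h1 : q%:R ^+ Pi * (x ^+ 3) ^+ T <= q%:R ^+ (k ^ d).
    rewrite -exprM xpow !qpow -powRD ?(gt_eqF q0) ?implybT //.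
    apply: ler_powR => //; rewrite kdE natrM TE d1E.
    have -> : 3%:R * ((K - a) * d%:R) * (K * K ^+ (d - 2) / (2 * d%:R)) =
       3 / 2 * (K - a) * K * K ^+ (d - 2) by field; rewrite gt_eqF.
    have : Pi%:R <= a * a * K ^+ (d - 2).
      apply: le_trans hPi _; rewrite -{1}(subnKC hd) exprD expr2.
      apply: ler_wpM2l; first by rewrite mulr_ge0.
      by apply: lerX.
    (* The difference of the two sides is at least this product. *)
    have : 0 <= (K - a) * (a - K / 2) * K ^+ (d - 2).
      by rewrite !mulr_ge0 ?subr_ge0 // ltW.
    lra.
  have h2 : P%:R <= (K ^+ 2 * x ^+ 2) ^+ T.
    apply: (@le_trans _ _ ((K * n%:R) ^+ T)); last first.
      apply: lerX; first by rewrite mulr_ge0 // ltW.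
      by rewrite [K ^+ 2]expr2 -mulrA ler_pM2l.
    rewrite -natrM -natrX ler_nat /P /T expn_sum; apply: leq_prod => j _.
    have /andP[_ sjk] := hs j.
    by rewrite expnMn -bin_sub // leq_mul ?bin_le_exp.
  have xT0 : 0 < (x ^+ 3) ^+ T by rewrite !exprn_gt0.
  apply: (@le_trans _ _ ((K ^+ 2 / x) ^+ T * q%:R ^+ (k ^ d))).
    rewrite -(ler_pM2r xT0) -[leLHS]mulrA.
    apply: le_trans (ler_pM _ _ h2 h1) _ => //.
      by rewrite mulr_ge0 // ltW // exprn_gt0.
    rewrite [leRHS]mulrAC -[in leRHS]exprMn.
    by rewrite (_ : K ^+ 2 / x * x ^+ 3 = K ^+ 2 * x ^+ 2) //; field; rewrite gt_eqF.
  rewrite ler_wpM2r //.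
  have z0 : 0 <= K ^+ 2 / x by rewrite divr_ge0 ?sqr_ge0 // ltW.
  have z1 : K ^+ 2 / x <= 1 by lra.
  apply: (@le_trans _ _ (K ^+ 2 / x)).
    by rewrite -[leRHS]expr1; apply: ler_wiXn2l.
  rewrite -[2 * _ * mu / x]mulrA mulrAC; nra.
Qed.

(** * Factorials and the exponential *)

(** k ^ k / k! is one term of the exponential series at k. *)
Lemma fact_expR_ge (R : realType) (k : nat) : k%:R ^+ k <= k`!%:R * expR k%:R :> R.
Proof.
case: k => [|k]; first by rewrite expr0 fact0 expR0 mulr1.
have := @expR_ge1Dxn R k.+1%:R k (ler0n _ _) => h.
rewrite mulrC -ler_pdivrMr ?ltr0n ?fact_gt0 //; lra.
Qed.

(** Raise 1 - 1/(k+1) <= exp(- 1/(k+1)) to the power k+1. *)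
Lemma expR1_le_succ (R : realType) (k : nat) :
  expR 1 * k%:R ^+ k.+1 <= k.+1%:R ^+ k.+1 :> R.
Proof.
have h : k%:R / k.+1%:R <= expR (- k.+1%:R^-1) :> R.
  have -> : k%:R / k.+1%:R = 1 + - k.+1%:R^-1 :> R.
    by rewrite -natr1; field; rewrite natr1 pnatr_eq0.
  exact: expR_ge1Dx.
have h2 : (k%:R / k.+1%:R) ^+ k.+1 <= expR (- 1) :> R.
  have -> : expR (- 1) = expR (- k.+1%:R^-1) ^+ k.+1 :> R.
    by rewrite -expRM_natr mulNr mulVf // pnatr_eq0.
  by apply: lerXn2r; rewrite ?nnegrE ?divr_ge0 ?expR_ge0.
move: h2; rewrite expr_div_n expRN ler_pdivrMr ?exprn_gt0 ?ltr0n //.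
by rewrite mulrC ler_pdivlMr ?expR_gt0 // mulrC.
Qed.

Lemma fact_expR_le (R : realType) (k : nat) : (0 < k)%N ->
  k`!%:R * expR k%:R <= expR 1 * k%:R ^+ k.+1 :> R.
Proof.
elim: k => // -[_ _|k IH _]; first by rewrite mul1r expr1n mulr1.
have {}IH := IH isT; rewrite factS natrM -[in expR _]natr1 expRD.
set a := k.+1 in IH *.
have p0 : 0 <= a.+1%:R * expR 1 :> R by rewrite mulr_ge0 ?expR_ge0.
have h1 := ler_wpM2l p0 IH; have h2 := ler_wpM2l p0 (expR1_le_succ R a).
apply: (@le_trans _ _ (a.+1%:R * expR 1 * (expR 1 * a%:R ^+ a.+1))).
  by apply: le_trans h1; rewrite le_eqVlt; apply/orP; left; apply/eqP; ring.
apply: le_trans h2 _; rewrite [X in _ <= _ * X]exprS.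
by rewrite le_eqVlt; apply/orP; left; apply/eqP; ring.
Qed.

(** * Sides that suffice and sides that are needed *)

(** With mu bounding the expected number of copies from above and the last
    hypothesis bounding it from below by 2 q k ^ d, the random array is universal
    with positive probability. *)
Lemma has_universal_of_real (R : realType) (d q k n : nat) (mu x : R) :
  (2 <= d)%N -> (2 <= q)%N -> (2 <= k)%N ->
  (2 * k <= n)%N -> x = q%:R `^ (k%:R ^+ (d - 1) / (2 * d%:R)) ->
  x ^+ 2 <= n%:R <= k%:R * x ^+ 2 -> ('C(n, k) ^ d)%:R <= mu * q%:R ^+ (k ^ d) ->
  1 <= mu -> 2 * k%:R ^+ 2 <= x ->
  8 * k.+1%:R ^+ d * (2 * k%:R ^+ 2 * mu) <= x ->
  (2 * q * k ^ d * q ^ (k ^ d) <= 'C(n, k) ^ d)%N ->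
  has_universal d q k n.
Proof.
move=> hd hq hk kn xE hn hmu mu1 hx hx2 hM.
have x0 : 0 < x by rewrite xE powR_gt0 // ltr0n (leq_trans _ hq).
have q0 : (0 < q)%N by apply: leq_trans hq.
have k0 : (0 < k)%N by apply: leq_trans hk.
set c := (k ^ d)%N in hM hmu *.
have c0 : (0 < c)%N by rewrite expn_gt0 k0.
have qc0 : 0 < q%:R ^+ c :> R by rewrite exprn_gt0 // ltr0n.
apply: has_universal_of_overlap => //.
- apply: (@leq_trans (2 ^ c)); last by rewrite leq_exp2r.
  apply: (@leq_trans (2 ^ 4)) => //; rewrite leq_exp2l // /c.
  apply: (@leq_trans (2 ^ d)); first by rewrite (@leq_exp2l 2 2 d).
  by rewrite leq_exp2r // (leq_trans _ hd).
- move=> I IS.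
  apply: (@leq_trans (8 * (k.+1 ^ d * (q ^ c %/ (8 * k.+1 ^ d))))).
    rewrite leq_mul2l /=; apply: overlap_sum_le => // s hs hs'.
    rewrite leq_divRL ?muln_gt0 ?expn_gt0 // -(ler_nat R) natrM natrX.
    have h := overlap_term_le hd hq hs hs' kn xE hn hmu mu1 hx.
    apply: le_trans (ler_wpM2r _ h) _; first exact: ler0n.
    rewrite natrM natrX mulrAC ler_piMl ?(ltW qc0) //.
    by rewrite mulrAC ler_pdivrMr // mul1r mulrC.
  by rewrite mulnA mulnC leq_trunc_div.
- rewrite -(ltr_nat R) natrM !natrX; set N := ('C(n, k) ^ d)%N.
  set X := (2 * q ^ c)%N.
  have XE : X%:R = 2 * q%:R ^+ c :> R by rewrite natrM natrX.
  have X0 : 0 < X%:R :> R by rewrite XE mulr_gt0.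
  have h1 : X.-1%:R / X%:R <= expR (- X%:R^-1) :> R.
    apply: le_trans (expR_ge1Dx _).
    have -> : X.-1%:R = X%:R - 1 :> R 
      by rewrite -[in RHS](@prednK X) -?(ltr0n R) // -natr1 addrK.
    by rewrite mulrBl mul1r divff ?gt_eqF.
  have h2 : X.-1%:R ^+ N <= X%:R ^+ N * expR (- (q * c)%:R) :> R.
    rewrite -ler_pdivrMl ?exprn_gt0 // mulrC -expr_div_n.
    apply: (@le_trans _ _ (expR (- X%:R^-1) ^+ N)).
      by apply: lerXn2r; rewrite ?nnegrE ?divr_ge0 ?expR_ge0.
    rewrite -expRM_natr ler_expR mulNr lerN2 mulrC ler_pdivlMr //.
    by rewrite -natrM ler_nat; apply: leq_trans hM; rewrite /X; lia.
  (* The number q ^ c of arrays B is below exp(q c), because q < exp q. *)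
  have h3 : q%:R ^+ c < expR (q * c)%:R :> R.
    rewrite natrM expRM_natr; rewrite ltr_pXn2r // ?nnegrE ?expR_ge0 //.
    have := @expR_gt1Dx R q%:R; rewrite pnatr_eq0 -lt0n q0 => /(_ isT); lra.
  have XN0 : 0 < X%:R ^+ N :> R by rewrite exprn_gt0.
  apply: (@le_lt_trans _ _ (q%:R ^+ c * (X%:R ^+ N * expR (- (q * c)%:R)))).
    by rewrite ler_pM2l.
  rewrite mulrCA gtr_pMr // expRN ltr_pdivrMr ?expR_gt0 // mul1r; exact: h3.
Qed.

Local Open Scope classical_set_scope.

Lemma ffact_le_exp (n k : nat) : (n ^_ k <= n ^ k)%N.
Proof.
by elim: k => // k IH; rewrite ffactnSr expnSr leq_mul // leq_subr.
Qed.

Lemma exp_le_ffact (n k : nat) : ((n - k) ^ k <= n.-1 ^_ k)%N.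
Proof.
elim: k => // k IH; rewrite ffactnSr expnSr.
apply: leq_mul; last by lia.
by apply: leq_trans IH; case: k => // k; rewrite leq_exp2r //; lia.
Qed.

Definition growth (R : realType) (d q k : nat) : R :=
  k%:R / expR 1 * q%:R `^ (k%:R ^+ (d - 1) / d%:R).

Lemma powR_side_exp (R : realType) (d q k : nat) : (0 < d)%N ->
  (q%:R `^ (k%:R ^+ (d - 1) / d%:R)) ^+ (k * d) = q%:R ^+ (k ^ d) :> R.
Proof.
move=> d0; rewrite -powR_mulrn ?powR_ge0 // -powRrM -[RHS]powR_mulrn //.
congr (_ `^ _); rewrite natrM [k%:R * _]mulrC mulrA divfK ?pnatr_eq0 -?lt0n //.
by rewrite natrX -exprSr -subSn // subn1.
Qed.

Lemma side_ge (R : realType) (d q k n : nat) : (0 < d)%N -> (0 < k)%N ->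
  (q ^ (k ^ d) <= 'C(n, k) ^ d)%N ->
  growth R d q k <= n%:R.
Proof.
move=> d0 k0 h; rewrite /growth.
have kd0 : (0 < k * d)%N by rewrite muln_gt0 k0.
have K0 : 0 <= k%:R / expR 1 :> R by rewrite divr_ge0 ?expR_ge0.
rewrite -(ler_pXn2r kd0) ?nnegrE ?mulr_ge0 ?powR_ge0 //.
rewrite exprMn powR_side_exp // exprM.
have h1 : (k%:R / expR 1) ^+ k <= k`!%:R :> R.
  rewrite expr_div_n ler_pdivrMr ?exprn_gt0 ?expR_gt0 // -expRM_natr mul1r.
  exact: fact_expR_ge.
have h2 : q%:R ^+ (k ^ d) <= 'C(n, k)%:R ^+ d :> R by rewrite -!natrX ler_nat.
apply: (@le_trans _ _ (k`!%:R ^+ d * 'C(n, k)%:R ^+ d)).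
  apply: ler_pM => //; rewrite ?exprn_ge0 //.
  by apply: lerXn2r; rewrite ?nnegrE ?exprn_ge0.
rewrite -exprMn -natrM mulnC bin_ffact exprM -!natrX ler_nat leq_exp2r //.
exact: ffact_le_exp.
Qed.

(** Up to the polynomial factor in the last hypothesis, which y absorbs, the upper
    bound on C(n-1, k) reverses the counting bound. *)
Lemma side_le (R : realType) (d q k n : nat) (y : R) : (0 < d)%N -> (0 < k)%N ->
  (k <= n)%N -> ('C(n.-1, k) ^ d <= 2 * q * k ^ d * q ^ (k ^ d))%N -> 0 <= y ->
  2 * q%:R * expR 1 ^+ d * k%:R ^+ (2 * d) <= y ^+ (k * d) ->
  n%:R <= k%:R + growth R d q k * y.
Proof.
move=> d0 k0 kn h y0 hy; rewrite /growth.
have kd0 : (0 < k * d)%N by rewrite muln_gt0 k0.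
have K0 : 0 <= k%:R / expR 1 :> R by rewrite divr_ge0 ?expR_ge0.
rewrite -lerBlDl -natrB //.
rewrite -(ler_pXn2r kd0) ?nnegrE ?mulr_ge0 ?powR_ge0 //.
rewrite exprMn [(_ * _ `^ _) ^+ _]exprMn powR_side_exp //.
have e0 : 0 < expR k%:R ^+ d :> R by rewrite exprn_gt0 ?expR_gt0.
have h1 : k`!%:R ^+ d * expR k%:R ^+ d <= expR 1 ^+ d * k%:R ^+ (k.+1 * d) :> R.
  rewrite -exprMn exprM -exprMn; apply: lerXn2r; rewrite ?nnegrE ?mulr_ge0 ?exprn_ge0 ?expR_ge0 //.
  exact: fact_expR_le.
have h2 : (n - k)%:R ^+ (k * d) <= 'C(n.-1, k)%:R ^+ d * k`!%:R ^+ d :> R.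
  rewrite -exprMn -natrM bin_ffact exprM -!natrX ler_nat leq_exp2r //.
  exact: exp_le_ffact.
have h3 : 'C(n.-1, k)%:R ^+ d <= 2 * q%:R * k%:R ^+ d * q%:R ^+ (k ^ d) :> R.
  by rewrite -!natrX -!natrM ler_nat.
apply: le_trans h2 _.
have -> : (k%:R / expR 1) ^+ (k * d) = k%:R ^+ (k * d) / expR k%:R ^+ d :> R.
  by rewrite expr_div_n [expR 1 ^+ (k * d)]exprM -expRM_natr mul1r.
rewrite -(ler_pM2r e0) -mulrA.
apply: (@le_trans _ _ ((2 * q%:R * k%:R ^+ d * q%:R ^+ (k ^ d)) *
    (expR 1 ^+ d * k%:R ^+ (k.+1 * d)))).
  by apply: ler_pM; rewrite ?mulr_ge0 ?exprn_ge0 ?expR_ge0.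
have -> : k%:R ^+ (k * d) / expR k%:R ^+ d * q%:R ^+ (k ^ d) * y ^+ (k * d) * expR k%:R ^+ d
   = k%:R ^+ (k * d) * q%:R ^+ (k ^ d) * y ^+ (k * d) :> R.
  by field; rewrite gt_eqF // expR_gt0.
have -> : 2 * q%:R * k%:R ^+ d * q%:R ^+ (k ^ d) * (expR 1 ^+ d * k%:R ^+ (k.+1 * d))
  = k%:R ^+ (k * d) * q%:R ^+ (k ^ d) * (2 * q%:R * expR 1 ^+ d * k%:R ^+ (2 * d)) :> R.
  by rewrite mulSn mul2n -addnn !exprD; ring.
by apply: ler_wpM2l => //; rewrite mulr_ge0 ?exprn_ge0.
Qed.

(** * Asymptotics *)

Lemma poly_le_expR (R : realType) (C c : R) (m : nat) : 0 < c ->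
  \forall k \near \oo, C * k%:R ^+ m <= expR (c * k%:R).
Proof.
move=> c0; near=> k.
have k0 : 0 <= k%:R :> R by [].
have f0 : 0 < (m.+1)`!%:R :> R by rewrite ltr0n fact_gt0.
have cm : 0 < c ^+ m.+1 by rewrite exprn_gt0.
have hk : C * (m.+1)`!%:R / c ^+ m.+1 <= k%:R by near: k; exact: nbhs_infty_ger.
have h := @expR_ge1Dxn R (c * k%:R) m (mulr_ge0 (ltW c0) k0).
suff : C * k%:R ^+ m <= (c * k%:R) ^+ m.+1 / (m.+1)`!%:R by lra.
rewrite ler_pdivlMr // exprMn [k%:R ^+ m.+1]exprS mulrA [leLHS]mulrAC.
rewrite ler_wpM2r ?exprn_ge0 //.
by move: hk; rewrite ler_pdivrMr // [k%:R * _]mulrC.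
Unshelve. all: by end_near.
Qed.

Lemma bin_threshold (d k M : nat) : (0 < d)%N -> (0 < k)%N -> (0 < M)%N ->
  exists n, (M <= 'C(n, k) ^ d)%N /\ ('C(n.-1, k) ^ d < M)%N.
Proof.
move=> d0 k0 M0.
have ex : exists n, (M <= 'C(n, k) ^ d)%N.
  exists (k + M * k`!)%N; apply: (@leq_trans 'C(k + M * k`!, k)%N); last first.
    case: ('C(_, _)) => [|c]; first by rewrite exp0n.
    by rewrite -[X in (X <= _)%N]expn1 leq_pexp2l.
  rewrite -(@leq_pmul2r k`!) ?fact_gt0 // bin_ffact.
  apply: (@leq_trans ((k + M * k`!).+1.-1 ^_ k)) => //.
  apply: leq_trans (exp_le_ffact _ _).
  apply: (@leq_trans ((k + M * k`!).+1 - k)); first by lia.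
  by case: k k0 => // k _; rewrite -[X in (X <= _)%N]expn1 leq_pexp2l //; lia.
case: (ex_minnP ex) => n hn hmin; exists n; split => //.
have n0 : (0 < n)%N.
  by case: n hn {hmin} => //; rewrite bin0n (gtn_eqF k0) exp0n //; lia.
rewrite ltnNge; apply/negP => /hmin; lia.
Qed.

Lemma min_universal_spec (d q k n : nat) : has_universal d q k n ->
  has_universal d q k (min_universal d q k) /\ (min_universal d q k <= n)%N.
Proof.
move=> hn.
have ex : exists m, `[< has_universal d q k m >] by exists n; apply/asboolP.
have [|h1 h2] := @xgetPex _ 0%N [set m | has_universal d q k m /\
    forall n', has_universal d q k n' -> (m <= n')%N]%classic.
  case: (ex_minnP ex) => m /asboolP hm hmin; exists m; split => // n' hn'.
  by apply: hmin; apply/asboolP.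
by split; [|apply: h2].
Qed.

(** Minimality of n controls C(n-1, k) from above; this transfers the control to
    C(n, k). *)
Lemma bin_le_double_pred (n k : nat) : (0 < k)%N -> (2 * k <= n)%N ->
  ('C(n, k) <= 2 * 'C(n.-1, k))%N.
Proof.
move=> k0 kn; have h := mul_bin_down n k.
have nk0 : (0 < n - k)%N by lia.
rewrite -(leq_pmul2l nk0) -h; nia.
Qed.

(** The upper estimate exhibits a universal array of the least order n to which the
    union bound applies. Requiring eps <= 1 gives n <= 2 (k/e) Q <= k Q, the crude
    bound that the overlap estimate uses; the other conditions mostly compare a
    polynomial in k with an exponential. *)
Lemma min_universal_near (R : realType) (d q : nat) (eps : R) :
  (2 <= d)%N -> (2 <= q)%N -> 0 < eps <= 1 ->
  \forall k \near \oo,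
    growth R d q k <= (min_universal d q k)%:R <= (1 + eps) * growth R d q k.
Proof.
move=> hd hq /andP[eps0 eps1].
have d0 : (0 < d)%N by apply: leq_trans hd.
have q0 : (0 < q)%N by apply: leq_trans hq.
have dR0 : 0 < d%:R :> R by rewrite ltr0n.
have lq0 : 0 < ln q%:R :> R by rewrite ln_gt0 // ltr1n.
pose y := 1 + eps / 2; have y1 : 1 < y by rewrite /y; lra.
pose c := ln q%:R / (2 * d%:R) : R.
have c0 : 0 < c by rewrite divr_gt0 // mulr_gt0.
have cy0 : 0 < ln y * d%:R by rewrite mulr_gt0 // ln_gt0.
pose e := expR 1 : R.
have e2 : 2 <= e by have := @expR_ge1Dx R 1; rewrite /e; lra.
(* Ca bounds the constants of 8 (k+1)^d 2 k^2 mu, using k + 1 <= 2 k. *)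
pose Ca := 8 * 2 ^+ d * (2 * (2 ^+ d * (2 * q%:R))) : R.
near=> k.
have hk2 : (2 <= k)%N by near: k; exact: nbhs_infty_ge.
have hke : e <= k%:R by near: k; exact: nbhs_infty_ger.
have H1 : 2 * q%:R * e ^+ d * k%:R ^+ (2 * d) <= expR (ln y * d%:R * k%:R).
  by near: k; exact: poly_le_expR.
have H2 : Ca * k%:R ^+ (2 * d + 2) <= expR (c * k%:R).
  by near: k; exact: poly_le_expR.
have H3 : 2 * k%:R ^+ 2 <= expR (c * k%:R) by near: k; exact: poly_le_expR.
have H4 : 2 * e / eps * k%:R ^+ 0 <= expR (c * k%:R) by near: k; exact: poly_le_expR.
have k0 : (0 < k)%N by apply: leq_trans hk2.
set x := q%:R `^ (k%:R ^+ (d - 1) / (2 * d%:R)) : R.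
have kR1 : 1 <= k%:R :> R by rewrite ler1n.
have ckx : expR (c * k%:R) <= x.
  rewrite /x /powR gt_eqF ?ltr0n // ler_expR.
  have -> : c * k%:R = k%:R / (2 * d%:R) * ln q%:R by rewrite /c; ring.
  rewrite ler_pM2r // ler_pM2r ?invr_gt0 ?mulr_gt0 //.
  by rewrite -[leLHS]expr1 ler_weXn2l // subn_gt0.
have QE : q%:R `^ (k%:R ^+ (d - 1) / d%:R) = x ^+ 2.
  rewrite -powR_mulrn ?powR_ge0 // -powRrM; congr (_ `^ _).
  by field; rewrite gt_eqF.
have hx3 := le_trans H3 ckx; have hx2 := le_trans H2 ckx.
have hx4 : 2 * e / eps <= x by apply: le_trans ckx; move: H4; rewrite expr0 mulr1.
have x4 : 4 <= x.
  apply: le_trans hx4; rewrite ler_pdivlMr //; nra.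
have hx4' : 2 * e <= x * eps by rewrite -ler_pdivrMr.
set F := growth R d q k.
have FE' : F = k%:R / e * x ^+ 2 by rewrite /F /growth QE.
have FE : F * e = k%:R * x ^+ 2 by rewrite FE' mulrAC divfK // gt_eqF //; lra.
have M0 : (0 < 2 * q * k ^ d * q ^ (k ^ d))%N.
  by rewrite !muln_gt0 !expn_gt0 q0 k0.
(* The factor 2 q k ^ d is the expected number of copies of each array that the
   union bound requires. *)
have [n [hn hn']] := bin_threshold d0 k0 M0.
have leFn : F <= n%:R.
  apply: side_ge => //; apply: leq_trans hn.
  by rewrite leq_pmull // !muln_gt0 expn_gt0 q0 k0.
have x2 : 2 * e <= eps * x ^+ 2 by nra.
have kn : (2 * k <= n)%N.
  rewrite -(ler_nat R) natrM; apply: le_trans leFn.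
  rewrite -(ler_pM2r (_ : 0 < e)) ?FE; last by lra.
  nra.
have kF : k%:R <= eps / 2 * F.
  rewrite -(ler_pM2r (_ : 0 < e)); last by lra.
  rewrite -[leRHS]mulrA FE; nra.
have nF : n%:R <= (1 + eps) * F.
  have kn' : (k <= n)%N by apply: leq_trans kn; rewrite leq_pmull.
  have y0 : 0 <= y by lra.
  have := @side_le R d q k n y d0 k0 kn' (ltnW hn') y0.
  rewrite -/F => h.
  apply: le_trans (h _) _; last by rewrite /y; lra.
  apply: le_trans H1 _.
  rewrite -mulrA -natrM mulnC expRM_natr lnK // posrE; lra.
have F0 : 0 <= F by rewrite FE' mulr_ge0 ?sqr_ge0 // divr_ge0 ?expR_ge0.
have hun : has_universal d q k n.
  apply: (@has_universal_of_real R d q k n (2 ^+ d * (2 * q%:R * k%:R ^+ d)) x) => //.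
  - apply/andP; split.
      by apply: le_trans leFn; rewrite FE' ler_peMl ?sqr_ge0 // ler_pdivlMr ?mul1r //; lra.
    apply: le_trans nF _; rewrite -FE; nra.
  - have hbin := bin_le_double_pred k0 kn.
    have hbin' : ('C(n, k) ^ d <= 2 ^ d * (2 * q * k ^ d * q ^ (k ^ d)))%N.
      apply: leq_trans (_ : (2 * 'C(n.-1, k)) ^ d <= _)%N; first by rewrite leq_exp2r.
      by rewrite expnMn leq_mul2l (ltnW hn') orbT.
    move: hbin'; rewrite -(ler_nat R) natrM natrX [(2 * q * k ^ d * _)%:R]natrM.
    by rewrite [(2 * q * k ^ d)%:R]natrM [(2 * q)%:R]natrM !natrX !mulrA.
  - rewrite -!natrX -!natrM ler1n !muln_gt0 !expn_gt0 q0 k0 //.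
  - apply: le_trans hx2; rewrite /Ca.
    have -> : 8 * 2 ^+ d * (2 * (2 ^+ d * (2 * q%:R))) * k%:R ^+ (2 * d + 2) =
       8 * (2 * k%:R) ^+ d * (2 * k%:R ^+ 2 * (2 ^+ d * (2 * q%:R * k%:R ^+ d))) :> R.
      by rewrite exprMn mul2n -addnn !exprD; ring.
    have le2 : k.+1%:R ^+ d <= (2 * k%:R) ^+ d :> R.
      apply: lerXn2r; rewrite ?nnegrE ?mulr_ge0 //.
      by rewrite -natrM ler_nat mul2n -addnn -addn1 leq_add2l.
    by rewrite ler_wpM2r ?mulr_ge0 ?exprn_ge0 ?ler0n // ler_wpM2l.
have [hmin le_min] := min_universal_spec hun.
apply/andP; split; last by apply: le_trans nF; rewrite ler_nat.
by apply: side_ge => //; apply: has_universal_bin.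
Unshelve. all: by end_near.
Qed.

Unset Implicit Arguments.

Theorem corollary4 (R : realType) (d q : nat) (hd : (2 <= d)%N) (hq : (2 <= q)%N) :
  exists o : nat -> R,
    (o k @[k --> \oo] --> (0 : R)) /\
    forall k : nat, (1 <= k)%N ->
      (min_universal d q k)%:R =
        (1 + o k) * (k%:R / expR 1) * q%:R `^ (k%:R ^+ (d - 1) / d%:R).
Proof.
have growth_gt0 k : (1 <= k)%N -> 0 < growth R d q k.
  move=> k0; rewrite /growth mulr_gt0 ?powR_gt0 ?divr_gt0 ?expR_gt0 ?ltr0n //.
  exact: leq_trans hq.
exists (fun k => (min_universal d q k)%:R / growth R d q k - 1); split; last first.
  move=> k /growth_gt0 /gt_eqF g0.
  by rewrite -mulrA -/(growth R d q k) addrC subrK divfK // g0.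
apply/cvgrPdist_le => eps eps0; pose eps' := Num.min eps 1.
have eps'01 : 0 < eps' <= 1 by rewrite lt_min eps0 ltr01 ge_min lexx orbT.
near=> k.
have k0 : (1 <= k)%N by near: k; exact: nbhs_infty_ge.
have /andP[lo hi] : growth R d q k <= (min_universal d q k)%:R <= (1 + eps') * growth R d q k.
  by near: k; apply: min_universal_near.
have g0 := growth_gt0 k k0.
rewrite sub0r normrN ger0_norm ?subr_ge0 ?ler_pdivlMr ?mul1r //.
rewrite lerBlDl ler_pdivrMr //; apply: le_trans hi _.
by rewrite ler_wpM2r ?(ltW g0) // lerD2l ge_min lexx.
Unshelve. all: by end_near.
Qed.
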